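(* Let $\mathcal{K}$ be a family of non-degenerate convex polygons in $\mathbb{R}^2$. Consider the following conditions on $\mathcal{K}$, where for each $K\in\mathcal{K}$ the set $V$ and the quantities $h_*,h_K,\rho_K$ are those of $K$: (H1) there is a constant $C_*>0$ such that $h_*\ge C_*h_K$ for all $K\in\mathcal{K}$; (H2) there is a constant $D_*>0$ such that $|\boldsymbol{u}-\boldsymbol{v}|\ge D_*h_K$ for all $K\in\mathcal{K}$ and all $\boldsymbol{u},\boldsymbol{v}\in V$ with $\boldsymbol{u}\ne\boldsymbol{v}$; (H3) there is a positive integer $N_V^*$ such that $|V|\le N_V^*$ for all $K\in\mathcal{K}$; (H5') there is a constant $\gamma^*>0$ such that $h_K/\rho_K\le\gamma^*$ for all $K\in\mathcal{K}$; (H6) there is $\alpha^*<\pi$ such that, for all $K\in\mathcal{K}$, all interior angles of $K$ are bounded above by $\alpha^*$; (H7) there is $\alpha_*>0$ such that, for all $K\in\mathcal{K}$, all interior angles of $K$ are bounded below by $\alpha_*$. Then (H6) $\Rightarrow$ (H3), (H5') $\Rightarrow$ (H7), and (H1) holds if and only if (H2), (H6) and (H7) all hold.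
   Context: A convex polygon $K\subset\mathbb{R}^2$ is the convex hull of finitely many points whose affine hull is $\mathbb{R}^2$. $V$ is its set of vertices and $F$ its set of facets (edges); $|V|$ denotes cardinality, while $|\boldsymbol{u}-\boldsymbol{v}|$ is Euclidean length. For $f\in F$, $V_f$ is the set of vertices contained in $f$. Non-degenerate: adjacent edges do not lie on the same line. $h_K$ is the diameter of $K$; $h_f(\boldsymbol{x})$ is the distance from $\boldsymbol{x}\in K$ to the line containing the edge $f$; $h_*=\min_{f\in F}\min_{\boldsymbol{v}\in V\setminus V_f}h_f(\boldsymbol{v})$; $\rho_K$ is the radius of the largest disc inscribed in $K$. *)

(* Defs.v *)
From HB Require Import structures.
From mathcomp Require Import all_boot all_order all_algebra.
From mathcomp Require Import all_classical all_reals all_analysis.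

Set Implicit Arguments.
Unset Strict Implicit.
Unset Printing Implicit Defensive.

Import Order.TTheory GRing.Theory Num.Theory.

Local Open Scope classical_set_scope.
Local Open Scope ring_scope.

Section ConvexPolygons.
Variable R : realType.

Local Notation plane := 'rV[R]_2.

Implicit Types (K S f g : set plane) (u v w x y c : plane) (KK : set (set plane)).

(* The norm that the library puts on matrices is the sup norm, hence the
   explicit Euclidean structure. *)
Definition dot u v : R := \sum_(i < 2) u 0 i * v 0 i.

Definition enorm u : R := Num.sqrt (dot u u).

Definition affine_hull S : set plane :=
  [set x | exists n (p : 'I_n -> plane) (a : 'I_n -> R),
    [/\ forall i, S (p i), \sum_i a i = 1 & x = \sum_i a i *: p i]].

Definition convex_hull S : set plane :=
  [set x | exists n (p : 'I_n -> plane) (a : 'I_n -> R),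
    [/\ forall i, S (p i), forall i, 0 <= a i, \sum_i a i = 1
      & x = \sum_i a i *: p i]].

Definition convex_polygon K : Prop :=
  exists S, [/\ finite_set S, affine_hull S = setT & K = convex_hull S].

(* Intersection of K with a supporting line, when nonempty. *)
Definition proper_face K f : Prop :=
  exists c (b : R), [/\ c != 0, forall x, K x -> dot c x <= b
                      & f = K `&` [set x | dot c x = b]].

Definition vertices K : set plane := [set v | proper_face K [set v]].

(* A proper face lies on a line, so that it has dimension 1 as soon as it
   contains two distinct points. *)
Definition edges K : set (set plane) :=
  [set f | proper_face K f /\ exists x y, [/\ f x, f y & x != y]].

Definition edge_vertices K f : set plane := vertices K `&` f.

(* With vertices and edges defined as faces this holds for every convex
   polygon. *)
Definition nondegenerate_polygon K : Prop :=
  forall f g, edges K f -> edges K g -> f <> g ->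
    edge_vertices K f `&` edge_vertices K g !=set0 ->
    affine_hull f <> affine_hull g.

Definition diameter K : R :=
  sup [set d | exists x y, [/\ K x, K y & d = enorm (x - y)]].

Definition line_dist f x : R :=
  inf [set enorm (x - y) | y in affine_hull f].

(* For a convex polygon, the set is finite and nonempty, and the infimum is a
   minimum. *)
Definition min_height K : R :=
  inf [set h | exists f v, [/\ edges K f,
                               (vertices K `\` edge_vertices K f) v
                             & h = line_dist f v]].

Definition disc c (r : R) : set plane := [set x | enorm (x - c) <= r].

Definition inradius K : R :=
  sup [set r | 0 < r /\ exists c, disc c r `<=` K].

(* The angle at v of the triangle u v w, in [0, pi]. *)
Definition angle u v w : R :=
  acos (dot (u - v) (w - v) / (enorm (u - v) * enorm (w - v))).

(* t is the interior angle of K at its vertex v, that is, the angle between the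
   two edges meeting at v; u and w are their other endpoints. *)
Definition interior_angle K v (t : R) : Prop :=
  exists f g u w,
    [/\ edges K f /\ edges K g, f <> g,
        edge_vertices K f v /\ edge_vertices K g v,
        edge_vertices K f u /\ edge_vertices K g w
      & [/\ u != v, w != v & t = angle u v w]].

Definition cond_H1 KK : Prop :=
  exists C : R, 0 < C /\ forall K, KK K -> min_height K >= C * diameter K.

Definition cond_H2 KK : Prop :=
  exists D : R, 0 < D /\ forall K, KK K ->
    forall u v, vertices K u -> vertices K v -> u != v ->
      enorm (u - v) >= D * diameter K.

Definition cond_H3 KK : Prop :=
  exists N : nat, (0 < N)%N /\ forall K, KK K -> (vertices K #<= `I_N)%card.

Definition cond_H5' KK : Prop :=
  exists gamma : R, 0 < gamma /\ forall K, KK K ->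
    diameter K / inradius K <= gamma.

Definition cond_H6 KK : Prop :=
  exists alpha : R, alpha < pi /\ forall K, KK K ->
    forall v t, vertices K v -> interior_angle K v t -> t <= alpha.

Definition cond_H7 KK : Prop :=
  exists alpha : R, 0 < alpha /\ forall K, KK K ->
    forall v t, vertices K v -> interior_angle K v t -> alpha <= t.

End ConvexPolygons.

(* Main.v *)
(* All conditions are read off the cosine z of an interior angle, spanned by unit
   vectors a and b along the two edges at a vertex v, between which K is seen
   from v.

   (H6) => (H3): the unit vector m_v opposite to a + b exposes v uniformly,
   <m_v, v - x> >= cos(theta/2) |x - v| on K. Adding this inequality at v and w
   gives |m_v - m_w| >= 2 cos(theta/2), and only boundedly many points of the unit
   disc can be that far apart.

   (H5') => (H7): a disc of radius r in K, with centre c, is at distance at least r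
   from both edge lines at v, whence 2 r <= |c - v| |b - a|.

   (H1) => (H2), (H6), (H7): a vertex w adjacent to v is at distance |w - v| sin(theta)
   from the line of the other edge at v.

   (H2), (H6), (H7) => (H1): over an edge, the lowest of the other vertices is
   adjacent to one of its endpoints, hence at height at least |w - v| sin(theta). *)
Require Import Defs.
From mathcomp Require Import all_boot all_order all_algebra.
From mathcomp Require Import all_classical all_reals all_analysis.
From mathcomp Require Import ring lra.

Set Implicit Arguments.
Unset Strict Implicit.
Unset Printing Implicit Defensive.

Import Order.TTheory GRing.Theory Num.Theory.

Local Open Scope classical_set_scope.
Local Open Scope ring_scope.

(** * Dot and cross products in the plane *)

Section EuclideanPlane.
Variable R : realType.
Implicit Types (u v w x y a b c d m n : 'rV[R]_2).

Definition cross u v : R := u 0 0 * v 0 1 - u 0 1 * v 0 0.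

Definition rot90 u : 'rV[R]_2 := \row_(i < 2) (if i == 0 then - u 0 1 else u 0 0).

Lemma dotE u v : dot u v = u 0 0 * v 0 0 + u 0 1 * v 0 1.
Proof.
rewrite /dot !big_ord_recl big_ord0 addr0 (_ : lift ord0 ord0 = 1) //.
exact: val_inj.
Qed.

Lemma row2P u v : u 0 0 = v 0 0 -> u 0 1 = v 0 1 -> u = v.
Proof.
move=> e0 e1; apply/rowP => -[[|[|//]] hi].
- by rewrite (_ : Ordinal hi = 0) //; apply: val_inj.
- by rewrite (_ : Ordinal hi = 1) //; apply: val_inj.
Qed.

Lemma dotC u v : dot u v = dot v u.
Proof. by rewrite !dotE; ring. Qed.

Lemma dotDr u v w : dot u (v + w) = dot u v + dot u w.
Proof. by rewrite !dotE !mxE; ring. Qed.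

Lemma dotBr u v w : dot u (v - w) = dot u v - dot u w.
Proof. by rewrite !dotE !mxE; ring. Qed.

Lemma dotZr u (k : R) v : dot u (k *: v) = k * dot u v.
Proof. by rewrite !dotE !mxE; ring. Qed.

Lemma dotDl u v w : dot (u + v) w = dot u w + dot v w.
Proof. by rewrite !dotE !mxE; ring. Qed.

Lemma dotBl u v w : dot (u - v) w = dot u w - dot v w.
Proof. by rewrite !dotE !mxE; ring. Qed.

Lemma dotZl (k : R) u v : dot (k *: u) v = k * dot u v.
Proof. by rewrite !dotE !mxE; ring. Qed.

Lemma dotNl u v : dot (- u) v = - dot u v.
Proof. by rewrite !dotE !mxE; ring. Qed.

Lemma dot0l u : dot 0 u = 0.
Proof. by rewrite !dotE !mxE; ring. Qed.

Lemma dot_rot90 u : dot u (rot90 u) = 0.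
Proof. by rewrite dotE !mxE /=; ring. Qed.

Lemma dot_sumr (I : finType) u (k : I -> R) (p : I -> 'rV[R]_2) :
  dot u (\sum_i k i *: p i) = \sum_i k i * dot u (p i).
Proof.
rewrite (big_morph (dot u) (dotDr u) (_ : dot u 0 = 0)) ?(dotC u) ?dot0l //.
by apply: eq_bigr => i _; rewrite dotZr.
Qed.

Lemma dot_ge0 u : 0 <= dot u u.
Proof. by rewrite dotE -!expr2 addr_ge0 ?sqr_ge0. Qed.

Lemma dot_eq0 u : dot u u = 0 -> u = 0.
Proof.
rewrite dotE -!expr2 => /eqP.
rewrite paddr_eq0 ?sqr_ge0 // !sqrf_eq0 => /andP[/eqP e0 /eqP e1].
by apply: row2P; rewrite mxE.
Qed.

Lemma dot_gt0 u : u != 0 -> 0 < dot u u.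
Proof.
by move=> u0; rewrite lt_neqAle dot_ge0 eq_sym andbT; apply: contraNneq u0 => /dot_eq0 ->.
Qed.

(** Testing with [d := x - y] gives |x - y|^2 <= 0. Points of a hull are known through bounds on
    functionals, and this turns such bounds into an equality. *)
Lemma dot_le_eq x y : (forall d, dot d x <= dot d y) -> x = y.
Proof.
move=> /(_ (x - y)); rewrite -subr_le0 -dotBr => h.
by apply/eqP; rewrite -subr_eq0; apply/eqP/dot_eq0/eqP; rewrite eq_le h dot_ge0.
Qed.

(** Lagrange's identity, in the role of cos^2 + sin^2 = 1. *)
Lemma dot_cross_sqr u v : dot u v ^+ 2 + cross u v ^+ 2 = dot u u * dot v v.
Proof. by rewrite !dotE /cross; ring. Qed.

Lemma enorm_ge0 u : 0 <= enorm u.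
Proof. exact: sqrtr_ge0. Qed.

Lemma sqr_enorm u : enorm u ^+ 2 = dot u u.
Proof. by rewrite sqr_sqrtr ?dot_ge0. Qed.

Lemma enorm_gt0 u : u != 0 -> 0 < enorm u.
Proof. by move=> u0; rewrite sqrtr_gt0 dot_gt0. Qed.

Lemma cauchy_schwarz u v : dot u v <= enorm u * enorm v.
Proof.
apply: (le_trans (ler_norm _)); rewrite -(@ler_pXn2r _ 2) ?nnegrE //; last first.
  by rewrite mulr_ge0 ?enorm_ge0.
by rewrite real_normK ?num_real // exprMn !sqr_enorm -dot_cross_sqr lerDl sqr_ge0.
Qed.

Lemma enormN u : enorm (- u) = enorm u.
Proof. by rewrite /enorm !dotE !mxE !mulrNN. Qed.

Lemma enormC u v : enorm (u - v) = enorm (v - u).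
Proof. by rewrite -opprB enormN. Qed.

Lemma enormZ (k : R) u : 0 <= k -> enorm (k *: u) = k * enorm u.
Proof.
move=> k0; apply/eqP; rewrite -(@eqrXn2 _ 2) ?enorm_ge0 ?mulr_ge0 ?enorm_ge0 //.
by rewrite exprMn !sqr_enorm dotZl dotZr mulrA expr2.
Qed.

Lemma ler_enormD u v : enorm (u + v) <= enorm u + enorm v.
Proof.
rewrite -(@ler_pXn2r _ 2) ?nnegrE ?enorm_ge0 ?addr_ge0 ?enorm_ge0 //.
rewrite sqr_enorm sqrrD !sqr_enorm dotDl !dotDr [dot v u]dotC.
by have := cauchy_schwarz u v; lra.
Qed.

Lemma orthogonal_parallel n a b :
  n != 0 -> a != 0 -> dot n a = 0 -> dot n b = 0 -> exists k : R, b = k *: a.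
Proof.
move=> n0 a0; rewrite !dotE => na nb.
exists (dot a b / dot a a).
have aa := dot_gt0 a0; have nn := dot_gt0 n0.
(* |n|^2 [cross a b] is a combination of [dot n a] and [dot n b], both zero. *)
have cab : cross a b = 0.
  have: dot n n * cross a b = 0.
    rewrite dotE /cross.
    have -> : (n 0 0 * n 0 0 + n 0 1 * n 0 1) * (a 0 0 * b 0 1 - a 0 1 * b 0 0) =
      (n 0 0 * a 0 0 + n 0 1 * a 0 1) * (n 0 0 * b 0 1 - n 0 1 * b 0 0) -
      (n 0 0 * b 0 0 + n 0 1 * b 0 1) * (n 0 0 * a 0 1 - n 0 1 * a 0 0) by ring.
    by rewrite na nb !mul0r subr0.
  by move/eqP; rewrite mulf_eq0 gt_eqF //= => /eqP.
(* Expansion of |a|^2 b in the orthogonal basis [a], [rot90 a]. *)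
have e0 : dot a a * b 0 0 = dot a b * a 0 0 - a 0 1 * cross a b.
  by rewrite !dotE /cross; ring.
have e1 : dot a a * b 0 1 = dot a b * a 0 1 + a 0 0 * cross a b.
  by rewrite !dotE /cross; ring.
rewrite cab mulr0 ?subr0 ?addr0 in e0 e1.
have aa0 : dot a a != 0 by rewrite gt_eqF.
by apply: row2P; rewrite mxE; apply: (mulfI aa0); rewrite ?e0 ?e1; field.
Qed.

End EuclideanPlane.

(** By Lagrange's identity, |c|^2 |x - y|^2 is the sum of the squares of the two differences. This
    makes [rot90 c] a tie-breaker along the level lines of [c]. *)
Lemma rot90_inj (R : realType) (c x y : 'rV[R]_2) : c != 0 ->
  dot c x = dot c y -> dot (rot90 c) x = dot (rot90 c) y -> x = y.
Proof.
move=> c0 e1 e2; apply/eqP; rewrite -subr_eq0; apply/eqP/dot_eq0.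
have := dot_cross_sqr c (x - y).
have -> : cross c (x - y) = dot (rot90 c) (x - y).
  by rewrite dotE /cross !mxE /=; ring.
rewrite !dotBr e1 e2 !subrr expr0n addr0 => /esym/eqP.
by rewrite mulf_eq0 gt_eqF ?dot_gt0 //= -dotBr => /eqP.
Qed.

Lemma rot90_eq0 (R : realType) (c : 'rV[R]_2) : c != 0 -> rot90 c != 0.
Proof.
apply: contra_neq => /rowP e; apply: row2P; move: (e 0) (e 1); rewrite !mxE //=.
by move=> /eqP; rewrite oppr_eq0 => /eqP ->.
Qed.

(** * Faces of convex hulls; vertices and edges for finitely many generators *)

Section ConvexHull.
Variable R : realType.
Implicit Types (u v w x y a b c d m n p : 'rV[R]_2) (S f : set 'rV[R]_2).
Implicit Types (s : seq 'rV[R]_2).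

Lemma convex_hull_le S m (b : R) x :
  (forall p, S p -> dot m p <= b) -> convex_hull S x -> dot m x <= b.
Proof.
move=> mS [k [p [a [Sp a0 a1 ->]]]]; rewrite dot_sumr -[b]mul1r -a1 mulr_suml.
by apply: ler_sum => i _; rewrite ler_wpM2l ?mS.
Qed.

(** The nonnegative terms [a i * (b - dot m (p i))] sum to zero, so a point of the face puts weight
    only on generators lying on the face. *)
Lemma face_convex_hull_le S m (b : R) d (e : R) x :
  (forall p, S p -> dot m p <= b) ->
  (forall p, S p -> dot m p = b -> dot d p <= e) ->
  convex_hull S x -> dot m x = b -> dot d x <= e.
Proof.
move=> mS dS [k [p [a [Sp a0 a1 ->]]]] mx.
have /psumr_eq0P az : \sum_i a i * (b - dot m (p i)) = 0.
  under eq_bigr do rewrite mulrBr.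
  by rewrite sumrB -mulr_suml a1 mul1r -dot_sumr mx subrr.
rewrite dot_sumr -[e]mul1r -a1 mulr_suml; apply: ler_sum => i _.
have /eqP : a i * (b - dot m (p i)) = 0.
  by apply: az => // j _; rewrite mulr_ge0 ?subr_ge0 ?mS.
rewrite mulf_eq0 => /orP[/eqP -> |]; first by rewrite !mul0r.
by rewrite subr_eq0 eq_sym => /eqP ?; rewrite ler_wpM2l ?dS.
Qed.

Lemma face_generator S m (b : R) x :
  (forall p, S p -> dot m p <= b) -> convex_hull S x -> dot m x = b ->
  exists2 p, S p & dot m p = b.
Proof.
move=> mS Sx mx; apply: contrapT => h.
(* If no generator reached [b], any bound would hold vacuously on the face, even 0 <= -1. *)
have : dot 0 x <= - 1 :> R.
  apply: (face_convex_hull_le mS _ Sx mx) => p Sp mp.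
  by case: h; exists p.
by rewrite dot0l lerNr oppr0 ler10.
Qed.

Lemma sub_convex_hull S : S `<=` convex_hull S.
Proof.
move=> x Sx; exists 1%N, (fun=> x), (fun=> 1).
by split; rewrite // ?big_ord1 ?scale1r.
Qed.

Lemma vertex_generator S v : vertices (convex_hull S) v -> S v.
Proof.
move=> [c [b [_ cK fE]]].
have [Kv cv] : (convex_hull S `&` [set x | dot c x = b]) v by rewrite -fE.
have [p Sp cp] := face_generator (fun p Sp => cK p (sub_convex_hull Sp)) Kv cv.
suff -> : v = p by [].
have : (convex_hull S `&` [set x | dot c x = b]) p.
  by split => //; exact: sub_convex_hull.
by rewrite -fE => ->.
Qed.

Lemma affine_hull_full S n (b : R) : affine_hull S = setT -> n != 0 ->
  exists2 p, S p & dot n p <> b.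
Proof.
move=> ST n0; apply: contrapT => h.
have nb x : dot n x = b.
  have : affine_hull S x by rewrite ST.
  move=> [k [p [a [Sp a1 ->]]]]; rewrite dot_sumr -[b]mul1r -a1 mulr_suml.
  by apply: eq_bigr => i _; congr (_ * _); apply: contrapT => np; apply: h; exists (p i).
by have := dot_gt0 n0; rewrite nb -(nb 0) dotC dot0l ltxx.
Qed.

Lemma argmax_seq (F : 'rV[R]_2 -> R) s :
  s != [::] -> exists2 x, x \in s & forall y, y \in s -> F y <= F x.
Proof.
elim: s => [//|x s IH] _; have [->|/IH [z zs zmax]] := eqVneq s [::].
  by exists x; rewrite ?mem_head // => y; rewrite inE => /eqP ->.
have [xz|zx] := leP (F x) (F z).
  exists z; rewrite ?inE ?zs ?orbT // => y.
  by rewrite inE => /predU1P[-> //|/zmax].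
exists x; rewrite ?mem_head // => y.
by rewrite inE => /predU1P[-> //|/zmax /le_trans]; apply; exact: ltW.
Qed.

(** A large weight on [n] lets one functional single out a lexicographic maximum of a finite set.
    Quantifying over all N >= M lets the thresholds of the induction be combined by a maximum. *)
Lemma lex_max_perturb s n d u :
  (forall x, x \in s -> x != u ->
     dot n x < dot n u \/ dot n x = dot n u /\ dot d x < dot d u) ->
  exists M : R, forall N, M <= N -> forall x, x \in s -> x != u ->
    dot (N *: n + d) x < dot (N *: n + d) u.
Proof.
elim: s => [|y s IH] lexs; first by exists 0.
have [|M HM] := IH; first by move=> x xs; apply: lexs; rewrite inE xs orbT.
have [yu|yu] := eqVneq y u.
  exists M => N MN x; rewrite inE => /predU1P[->|xs]; last exact: HM.
  by rewrite yu eqxx.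
(* Beyond the quotient, what [n] gains at [u] outweighs what [d] loses there; the 1 makes it strict.
   When [n] ties, the quotient is a division by zero and [d] alone decides. *)
exists (Num.max M ((dot d y - dot d u) / (dot n u - dot n y) + 1)) => N.
rewrite ge_max => /andP[MN yN] x; rewrite inE => /predU1P[-> _|xs]; last exact: HM.
rewrite !dotDl !dotZl.
have [lt_n|[-> lt_d]] := lexs y (mem_head _ _) yu; last by rewrite ltrD2l.
have gap : 0 < dot n u - dot n y by rewrite subr_gt0.
have : (dot d y - dot d u) / (dot n u - dot n y) < N.
  by apply: lt_le_trans yN; rewrite ltrDl.
by rewrite ltr_pdivrMr //; lra.
Qed.

Lemma lex_max_vertex s n d u : u \in s -> (exists2 x, x \in s & x != u) ->
  (forall x, x \in s -> x != u ->
     dot n x < dot n u \/ dot n x = dot n u /\ dot d x < dot d u) ->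
  vertices (convex_hull [set` s]) u.
Proof.
move=> us [y ys yu] /lex_max_perturb [M /(_ M (lexx M))].
set m := _ + d => mlt.
have mle p : [set` s] p -> dot m p <= dot m u.
  by move=> ps; have [->//|pu] := eqVneq p u; apply/ltW/mlt.
exists m, (dot m u); split.
- by apply: contraTneq (mlt y ys yu) => ->; rewrite !dot0l ltxx.
- by move=> x; exact: convex_hull_le.
- apply/seteqP; split => [x /= ->|x [Kx mx]].
    by split => //; exact: sub_convex_hull.
  apply: dot_le_eq => d'; apply: (face_convex_hull_le mle _ Kx mx) => p ps mp.
  have [-> //|pu] := eqVneq p u.
  by have := mlt p ps pu; rewrite mp ltxx.
Qed.

Lemma not_singleton s u : affine_hull [set` s] = setT -> exists2 x, x \in s & x != u.
Proof.
move=> full; have e0 : delta_mx 0 0 != 0 :> 'rV[R]_2.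
  by apply/eqP => /matrixP /(_ 0 0) /eqP; rewrite !mxE eqxx oner_eq0.
have [p ps pu] := affine_hull_full (dot (delta_mx 0 0) u) full e0.
by exists p => //; apply: contra_notN pu => /eqP ->.
Qed.

(** A generator on the face that maximizes [d] is the lexicographic maximum for [n], then [d];
    injectivity of the pair makes it the only one, hence a vertex. *)
Lemma face_vertex s n (b : R) d : affine_hull [set` s] = setT ->
  (forall x y, dot n x = dot n y -> dot d x = dot d y -> x = y) ->
  (forall p, p \in s -> dot n p <= b) -> (exists2 p, p \in s & dot n p = b) ->
  exists u, [/\ vertices (convex_hull [set` s]) u, dot n u = b &
    forall p, p \in s -> dot n p = b -> dot d p <= dot d u].
Proof.
move=> full nd_inj nb [p0 p0s np0].
have [|u] := @argmax_seq (dot d) [seq p <- s | dot n p == b].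
  by apply/eqP => E; have : p0 \in [::] by rewrite -E mem_filter np0 eqxx.
rewrite mem_filter => /andP[/eqP nu us] umax.
exists u; split => //; last first.
  by move=> p ps np; apply: umax; rewrite mem_filter np eqxx.
apply: (@lex_max_vertex _ n d) => //; first exact: not_singleton.
move=> x xs xu; have := nb x xs; rewrite le_eqVlt => /predU1P[nx|]; last by rewrite nu; left.
right; rewrite nx nu; split => //; rewrite lt_neqAle umax ?mem_filter ?nx ?eqxx // andbT.
by apply: contra_neq xu; apply: nd_inj; rewrite nx.
Qed.

Lemma vertex_exists s : affine_hull [set` s] = setT ->
  exists u, vertices (convex_hull [set` s]) u.
Proof.
move=> full; pose n : 'rV[R]_2 := delta_mx 0 0.
have n0 : n != 0 by apply/eqP => /matrixP /(_ 0 0) /eqP; rewrite !mxE eqxx oner_eq0.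
have [|p ps pmax] := @argmax_seq (dot n) s.
  by apply/eqP => s0; have [x] := not_singleton 0 full; rewrite s0.
have [|||u [Vu _ _]] := @face_vertex s n (dot n p) (rot90 n) full => //; last by exists u.
- by move=> x y; exact: rot90_inj.
- by exists p.
Qed.

(** The ends are the maximum and the minimum of [rot90 c] on the edge. Were they equal, [rot90 c]
    would be constant there and the edge a single point. *)
Lemma edge_two_vertices s f : affine_hull [set` s] = setT ->
  edges (convex_hull [set` s]) f ->
  exists u v, [/\ edge_vertices (convex_hull [set` s]) f u,
                  edge_vertices (convex_hull [set` s]) f v & u != v].
Proof.
move=> full [[c [b [c0 cK ->]]] [x [y [[Kx cx] [Ky cy] xy]]]].
have cs p : p \in s -> dot c p <= b by move=> ps; apply/cK/sub_convex_hull.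
have [p ps cp] : exists2 p, p \in s & dot c p = b.
  by have [p ps cp] := face_generator cs Kx cx; exists p.
have [|//||u [Vu cu umax]] := @face_vertex s c b (rot90 c) full.
- by move=> ? ?; exact: rot90_inj.
- by exists p.
have [|//||v [Vv cv vmin]] := @face_vertex s c b (- rot90 c) full.
- by move=> ? ?; rewrite !dotNl => ? /oppr_inj; exact: rot90_inj.
- by exists p.
have VK z : vertices (convex_hull [set` s]) z -> convex_hull [set` s] z.
  by move=> /vertex_generator; exact: sub_convex_hull.
exists u, v; split; [by do !split => //; exact: VK .. | ].
apply: contraNneq xy => uv; rewrite uv in umax.
have dv z : convex_hull [set` s] z -> dot c z = b -> dot (rot90 c) z = dot (rot90 c) v.
  move=> Kz cz; apply/eqP; rewrite eq_le (face_convex_hull_le cs umax Kz cz) /=.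
  by rewrite -lerN2 -!dotNl (face_convex_hull_le cs vmin Kz cz).
by apply/eqP/(rot90_inj c0); rewrite ?cx ?cy // !dv.
Qed.

(** [t] is the largest slope (d x - d v) / (c v - c x): tilting [d] by [t *: c] brings the steepest
    generators level with [v] and none above it. *)
Lemma max_slope s v c d :
  (forall x, x \in s -> x != v -> dot c x < dot c v) ->
  (exists2 x, x \in s & x != v) ->
  exists t : R, (forall x, x \in s -> dot (d + t *: c) x <= dot (d + t *: c) v) /\
    exists2 p, p \in s & p != v /\ dot (d + t *: c) p = dot (d + t *: c) v.
Proof.
move=> cv [x0 x0s x0v].
have [|p] := @argmax_seq (fun x => (dot d x - dot d v) / (dot c v - dot c x))
  [seq x <- s | x != v].
  by apply/eqP => E; have : x0 \in [::] by rewrite -E mem_filter x0v.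
rewrite mem_filter => /andP[pv ps] pmax.
have gap x : x \in s -> x != v -> 0 < dot c v - dot c x.
  by move=> xs xv; rewrite subr_gt0 cv.
set t := _ / _ in pmax; exists t; split => [x xs|].
  have [-> //|xv] := eqVneq x v.
  have := pmax x; rewrite mem_filter xv xs => /(_ isT).
  by rewrite ler_pdivrMr ?gap // !dotDl !dotZl; lra.
exists p => //; split => //.
have : t * (dot c v - dot c p) = dot d p - dot d v by rewrite divfK // gt_eqF ?gap.
by rewrite !dotDl !dotZl; lra.
Qed.

(* Among the lines through v and another generator, the two of extreme slope,
   measured against a functional c exposing v, carry the edges at v. *)
Lemma vertex_two_edges s v : affine_hull [set` s] = setT ->
  vertices (convex_hull [set` s]) v ->
  exists f g, [/\ edges (convex_hull [set` s]) f, edges (convex_hull [set` s]) g,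
                  f v, g v & f <> g].
Proof.
move=> full Vv; have sv := vertex_generator Vv.
have [c [b [c0 cK fE]]] := Vv.
have [Kv cv] : (convex_hull [set` s] `&` [set x | dot c x = b]) v by rewrite -fE.
have clt x : x \in s -> x != v -> dot c x < dot c v.
  move=> xs xv; rewrite cv lt_neqAle cK ?andbT; last exact: sub_convex_hull.
  apply: contra_neq xv => cx.
  have : (convex_hull [set` s] `&` [set x | dot c x = b]) x.
    by split => //; exact: sub_convex_hull.
  by rewrite -fE.
have nontriv := not_singleton v full.
have nz (e t : R) : e != 0 -> e *: rot90 c + t *: c != 0.
  move=> e0; apply/eqP => /(congr1 (dot (rot90 c))).
  rewrite dotDr !dotZr (dotC _ c) dot_rot90 mulr0 addr0 dotC dot0l => /eqP.
  by rewrite mulf_eq0 (negPf e0) gt_eqF // dot_gt0 ?rot90_eq0.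
have mkedge m p : m != 0 -> (forall x, x \in s -> dot m x <= dot m v) ->
    p \in s -> p != v -> dot m p = dot m v ->
    edges (convex_hull [set` s]) (convex_hull [set` s] `&` [set x | dot m x = dot m v]).
  move=> m0 ms ps pv mp; split.
    by exists m, (dot m v); split => // x; exact: convex_hull_le.
  by exists p, v; split => //; split => //; exact: sub_convex_hull.
have [t [ts [p ps [pv tp]]]] := max_slope (1 *: rot90 c) clt nontriv.
have [r [rs [q qs [qv rq]]]] := max_slope (-1 *: rot90 c) clt nontriv.
do 2 eexists; split.
- by apply: (mkedge _ p _ ts) => //; rewrite nz ?oner_eq0.
- by apply: (mkedge _ q _ rs) => //; rewrite nz ?oppr_eq0 ?oner_eq0.
- by [].
- by [].
(* Equal edges would share [p]. Adding the two equalities at [p] cancels [rot90 c] and gives r = -t,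
   so the two functionals are opposite and constant on all generators, against the full affine
   hull. *)
move=> /seteqP [/(_ p) fg _].
have {fg} rp : dot (-1 *: rot90 c + r *: c) p = dot (-1 *: rot90 c + r *: c) v.
  by have [] : (_ /\ _) := fg (conj (sub_convex_hull ps) tp).
have rt : r = - t.
  have : (r + t) * (dot c p - dot c v) = 0.
    by move: rp tp; rewrite !dotDl !dotZl; lra.
  by move/eqP; rewrite mulf_eq0 subr_eq0 [in X in _ || X]lt_eqF ?clt // orbF addr_eq0 => /eqP.
have [x xs] := affine_hull_full (dot (1 *: rot90 c + t *: c) v) full (nz _ t (oner_neq0 R)).
apply; apply/eqP; rewrite eq_le ts //=.
by have := rs x xs; rewrite rt !dotDl !dotZl; lra.
Qed.

End ConvexHull.

(** * Edges as supporting lines: cones, distances and angles *)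

Section Faces.
Variable R : realType.
Implicit Types (u v w x y a b c d e m n p : 'rV[R]_2) (K S f g : set 'rV[R]_2).
Implicit Types (s : seq 'rV[R]_2).

(** Both supporting functionals are orthogonal to [w - v], hence proportional, and cut out the same
    face. *)
Lemma edges_meet K f g v w : proper_face K f -> proper_face K g ->
  f v -> g v -> f w -> g w -> w != v -> f = g.
Proof.
move=> [c [b [c0 cK ->]]] [d [b' [d0 dK ->]]] /= [Kv cv] [_ dv] [Kw cw] [_ dw] wv.
have e0 : w - v != 0 by rewrite subr_eq0.
have [||k dk] := orthogonal_parallel e0 c0 (b := d).
- by rewrite dotC dotBr cv cw subrr.
- by rewrite dotC dotBr dv dw subrr.
have k0 : k != 0 by apply: contraNneq d0 => k0; rewrite dk k0 scale0r.
have bk : b' = k * b by rewrite -dv dk dotZl cv.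
apply/seteqP; split => x [Kx] /=; rewrite dk bk dotZl => h; split => //=.
  by rewrite h.
exact: (mulfI k0).
Qed.

(** The Binet-Cauchy identity with one vanishing term. It converts cross products with an edge
    direction into values of the supporting functional. *)
Lemma cross_orthogonal e c y : dot e c = 0 ->
  cross e y * cross e c = dot e e * dot c y.
Proof.
by move=> ec; rewrite -[LHS]addr0 -(mulr0 (dot e y)) -[in X in _ + X]ec !dotE /cross; ring.
Qed.

(** By [cross_orthogonal], [cross (u - v)] is a multiple of the supporting functional, so [K] stays
    on one side of the line. The product with the value at [w] tells which side without fixing an
    orientation. *)
Lemma edge_side K f v u w : proper_face K f -> f v -> f u -> u != v -> K w -> ~ f w ->
  cross (u - v) (w - v) != 0 /\
  forall x, K x -> 0 <= cross (u - v) (x - v) * cross (u - v) (w - v).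
Proof.
move=> [c [b [c0 cK ->]]] [Kv /= cv] [Ku /= cu] uv Kw fw.
have e0 : 0 < dot (u - v) (u - v) by rewrite dot_gt0 // subr_eq0.
set e := u - v in e0 *.
have ec : dot e c = 0 by rewrite dotC dotBr cu cv subrr.
have cw : dot c (w - v) < 0.
  rewrite dotBr cv subr_lt0 lt_neqAle cK // andbT.
  by apply/eqP => cw; apply: fw.
have ck : 0 < cross e c ^+ 2.
  by have := dot_cross_sqr e c; rewrite ec expr0n add0r => ->; rewrite mulr_gt0 // dot_gt0.
have ew : cross e (w - v) != 0.
  apply/eqP => ew; have := cross_orthogonal (w - v) ec; rewrite ew mul0r => /esym/eqP.
  by rewrite mulf_eq0 (gt_eqF e0) (lt_eqF cw).
split => // x Kx; rewrite -(pmulr_lge0 _ ck).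
have -> : cross e (x - v) * cross e (w - v) * cross e c ^+ 2 =
  (cross e (x - v) * cross e c) * (cross e (w - v) * cross e c) by ring.
rewrite !cross_orthogonal // mulrACA; apply: mulr_ge0; first by rewrite mulr_ge0 ?(ltW e0).
by apply: mulr_le0; rewrite ?(ltW cw) // dotBr cv subr_le0 cK.
Qed.

Lemma crossC a b : cross a b = - cross b a.
Proof. by rewrite /cross; ring. Qed.

(** The far end of each edge lies off the other edge and so tells the side of [K] there. [t] is the
    orientation sign of the pair [u - v], [w - v], common to both edges. *)
Lemma edges_cone K f g v u w : edges K f -> edges K g -> f <> g ->
  f v -> g v -> f u -> g w -> u != v -> w != v ->
  exists t : R, [/\ t ^+ 2 = 1, 0 < t * cross (u - v) (w - v) &
    forall x, K x -> 0 <= t * cross (x - v) (w - v) /\ 0 <= t * cross (u - v) (x - v)].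
Proof.
move=> [Ff _] [Fg _] fg fv gv fu gw uv wv.
have inK h z : proper_face K h -> h z -> K z by move=> [? [? [_ _ ->]]] [].
have nfw : ~ f w by move=> fw; apply: fg; exact: (edges_meet Ff Fg fv gv fw gw wv).
have ngu : ~ g u by move=> gu; apply: fg; exact: (edges_meet Ff Fg fv gv fu gu uv).
have [D0 fside] := edge_side Ff fv fu uv (inK _ _ Fg gw) nfw.
have [_ gside] := edge_side Fg gv gw wv (inK _ _ Ff fu) ngu.
have D1 : 0 < `|cross (u - v) (w - v)| by rewrite normr_gt0.
exists (Num.sg (cross (u - v) (w - v))); split.
- by rewrite sqr_sg D0.
- by rewrite -normrEsg.
move=> x Kx; split; rewrite -(pmulr_lge0 _ D1) mulrAC -numEsg mulrC.
  by rewrite crossC (crossC (u - v)) mulrNN gside.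
exact: fside.
Qed.

Lemma affine_hull_line f u v (t : R) : f u -> f v -> affine_hull f (v + t *: (u - v)).
Proof.
move=> fu fv; exists 2%N, (fun i => if i == 0 then v else u),
  (fun i => if i == 0 then 1 - t else t); split.
- by move=> i; case: ifP.
- by rewrite !big_ord_recl big_ord0 /= addr0 subrK.
- by rewrite !big_ord_recl big_ord0 /= addr0; apply: row2P; rewrite !mxE; ring.
Qed.

Lemma affine_hull_level f c (b : R) y : (forall x, f x -> dot c x = b) ->
  affine_hull f y -> dot c y = b.
Proof.
move=> cf [k [p [a [fp a1 ->]]]]; rewrite dot_sumr -[b]mul1r -a1 mulr_suml.
by apply: eq_bigr => i _; rewrite cf.
Qed.

Lemma line_dist_le f w y : affine_hull f y -> line_dist f w <= enorm (w - y).
Proof.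
move=> fy; apply: ge_inf; last by exists y.
by exists 0 => _ [z _ <-]; exact: enorm_ge0.
Qed.

Lemma line_dist_ge f x v (h : R) : f v ->
  (forall y, affine_hull f y -> h <= enorm (x - y)) -> h <= line_dist f x.
Proof.
move=> fv hf; apply: lb_le_inf; last by move=> _ [y /hf ? <-].
exists (enorm (x - (v + 0 *: (v - v)))), (v + 0 *: (v - v)) => //.
exact: affine_hull_line.
Qed.

Lemma line_dist_cross f u v w : f u -> f v -> u != v ->
  (line_dist f w) ^+ 2 * dot (u - v) (u - v) <= cross (u - v) (w - v) ^+ 2.
Proof.
move=> fu fv uv.
have e0 : 0 < dot (u - v) (u - v) by rewrite dot_gt0 // subr_eq0.
set e := u - v in e0 *.
(* Coordinate of the foot of the perpendicular from [w]. *)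
set t := dot e (w - v) / dot e e.
have h := line_dist_le w (affine_hull_line t fu fv).
have d0 : 0 <= line_dist f w by apply: (line_dist_ge fv) => y _; exact: enorm_ge0.
have -> : cross e (w - v) ^+ 2 = enorm (w - (v + t *: e)) ^+ 2 * dot e e.
  have te : t * dot e e = dot e (w - v) by rewrite divfK ?gt_eqF.
  rewrite sqr_enorm opprD addrA; clearbody t e; move: (w - v) te => z te.
  apply/esym; rewrite dotBl !dotBr !dotZl !dotZr (dotC z e).
  have -> : cross e z ^+ 2 = dot e e * dot z z - dot e z ^+ 2.
    by rewrite -dot_cross_sqr; ring.
  by rewrite -te; ring.
by rewrite ler_pM2r // ler_pXn2r ?nnegrE ?enorm_ge0.
Qed.

Lemma min_height_le K f x : edges K f -> vertices K x -> ~ f x ->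
  min_height K <= line_dist f x.
Proof.
move=> Ef Vx fx; apply: ge_inf; last by exists f, x; split => //; split => // -[].
exists 0 => _ [g [y [[_ [z [_ [gz _ _]]]] _ ->]]].
by apply: (line_dist_ge gz) => ? _; exact: enorm_ge0.
Qed.

(* Compare x with the points on the two edges adjacent to f that have the same
   height over f: they enclose x, which is impossible if x is a vertex and these
   points are not. *)
Lemma adjacent_height K c (r : R) u v g g' u' v' x :
  c != 0 -> (forall y, K y -> dot c y <= r) -> K u -> K v -> dot c u = r -> dot c v = r ->
  u != v ->
  proper_face K g -> g u -> g u' -> ~ g v -> dot c u' < r ->
  proper_face K g' -> g' v -> g' v' -> ~ g' u -> dot c v' < r ->
  vertices K x -> dot c x < r ->
  dot c x <= dot c u' \/ dot c x <= dot c v'.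
Proof.
move=> c0 cK Ku Kv cu cv uv Fg gu gu' gv cu' Fg' gv' gv'' gu'' cv' Vx cx.
have inK h z : proper_face K h -> h z -> K z by move=> [? [? [_ _ ->]]] [].
have [xu'|u'x] := leP (dot c x) (dot c u'); first by left.
have [xv'|v'x] := leP (dot c x) (dot c v'); first by right.
exfalso.
have Ku' := inK _ _ Fg gu'; have Kv' := inK _ _ Fg' gv''.
have e0 : v - u != 0 by rewrite subr_eq0 eq_sym.
have ce : dot c (v - u) = 0 by rewrite dotBr cv cu subrr.
(* [a] is the point of the segment from [p] to [q] level with [x]; the functional supporting that
   edge forces [x] to lie from [a] in the direction [o - p]. *)
have side h p q o : proper_face K h -> h p -> h q -> ~ h o -> K o ->
    dot c p = r -> dot c o = r -> dot c q < dot c x -> o - p != 0 ->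
    exists a (k l : R), [/\ a = p + l *: (q - p), 0 < l < 1, x = a + k *: (o - p) & 0 <= k].
  move=> [d [b [_ dK ->]]] [Kp /= dp] [Kq /= dq] ho Ko cp co qx op.
  have qp : 0 < r - dot c q by lra.
  set l := (r - dot c x) / (r - dot c q).
  have lq : l * (r - dot c q) = r - dot c x by rewrite divfK ?gt_eqF.
  have l01 : 0 < l < 1.
    apply/andP; split; first by rewrite divr_gt0 // subr_gt0.
    by rewrite ltr_pdivrMr // mul1r ltrD2l ltrN2.
  have [||k xk] := orthogonal_parallel c0 op (b := x - (p + l *: (q - p))).
  - by rewrite dotBr co cp subrr.
  - by rewrite dotBr dotDr dotZr dotBr cp; lra.
  exists (p + l *: (q - p)), k, l; split => //; first by rewrite -xk addrC subrK.
  have Kx : K x by case: Vx => ? [? [_ _ E]]; have : [set x] x by []; rewrite E => -[].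
  have do_lt : dot d (o - p) < 0.
    rewrite dotBr dp subr_lt0 lt_neqAle dK // andbT.
    by apply/eqP => do_; apply: ho.
  have : dot d (x - (p + l *: (q - p))) <= 0.
    by rewrite dotBr dotDr dotZr dotBr dp dq subrr mulr0 addr0 subr_le0 dK.
  by rewrite xk dotZr nmulr_lle0.
have [a [k [l [aE /andP[l0 l1] xa k0]]]] := side g u u' v Fg gu gu' gv Kv cu cv u'x e0.
have e1 : u - v != 0 by rewrite subr_eq0.
have [b [k' [l' [bE /andP[l'0 l'1] xb k'0]]]] :=
  side g' v v' u Fg' gv' gv'' gu'' Ku cv cu v'x e1.
case: Vx => d [b' [_ dK dE]].
have [Kx dx] : (K `&` [set y | dot d y = b']) x by rewrite -dE.
(* [d] is maximal at [x] only, so it cannot be maximal at both ends of a segment. *)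
have strict p q (t : R) : K p -> K q -> p != q -> 0 < t -> t < 1 ->
    dot d (p + t *: (q - p)) < b'.
  move=> Kp Kq pq t0 t1; rewrite dotDr dotZr dotBr.
  have [dp dq] := (dK _ Kp, dK _ Kq).
  rewrite -subr_gt0 (_ : _ - _ = (1 - t) * (b' - dot d p) + t * (b' - dot d q)); last by ring.
  have : dot d p < b' \/ dot d q < b'.
    move: dp; rewrite le_eqVlt => /predU1P[dp|]; last by left.
    move: dq; rewrite le_eqVlt => /predU1P[dq|]; last by right.
    have px : [set x] p by rewrite dE.
    have qx : [set x] q by rewrite dE.
    by move: pq; rewrite px qx eqxx.
  case => h; first by rewrite ltr_pwDl ?mulr_gt0 ?mulr_ge0 ?subr_gt0 ?subr_ge0 ?(ltW t0).
  by rewrite ltr_wpDl ?mulr_gt0 ?mulr_ge0 ?subr_gt0 ?subr_ge0 ?(ltW t1).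
have neq p q : dot c p = r -> dot c q < r -> p != q.
  by move=> cp; apply: contraTneq => <-; rewrite cp ltxx.
have da : dot d a < b' by rewrite aE strict // neq.
have db : dot d b < b' by rewrite bE strict // neq.
(* Going from [a] to [x], [d] increases along [v - u]; going from [b] to [x], along [u - v]. *)
move: dx => /=; rewrite {1}xa dotDr dotZr dotBr => dx.
move: (xb) => /(congr1 (dot d)); rewrite {1}xa !dotDr !dotZr !dotBr => dx'.
have kE : 0 < k * (dot d v - dot d u) by lra.
have kE' : 0 < k' * (dot d u - dot d v) by lra.
have [E0|E0] := leP (dot d v) (dot d u).
  by have := mulr_ge0_le0 k0 (_ : dot d v - dot d u <= 0); rewrite subr_le0 => /(_ E0); lra.
have := mulr_ge0_le0 k'0 (_ : dot d u - dot d v <= 0).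
by rewrite subr_le0 => /(_ (ltW E0)); lra.
Qed.

Definition cos_angle u v w : R := dot (u - v) (w - v) / (enorm (u - v) * enorm (w - v)).

Lemma cos_angle_itv u v w : -1 <= cos_angle u v w <= 1.
Proof.
have CS a b : dot a b / (enorm a * enorm b) <= 1.
  have := mulr_ge0 (enorm_ge0 a) (enorm_ge0 b).
  rewrite le_eqVlt => /predU1P[<-|h]; first by rewrite invr0 mulr0.
  by rewrite ler_pdivrMr // mul1r cauchy_schwarz.
rewrite CS andbT lerNl -mulNr -dotNl.
have -> : enorm (u - v) = enorm (- (u - v)) by rewrite opprB enormC.
exact: CS.
Qed.

(** Lagrange's identity read as sin^2 = 1 - cos^2. *)
Lemma cross_cos_angle u v w : u != v -> w != v ->
  cross (u - v) (w - v) ^+ 2 =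
  (1 - cos_angle u v w ^+ 2) * dot (u - v) (u - v) * dot (w - v) (w - v).
Proof.
move=> uv wv; rewrite /cos_angle expr_div_n exprMn !sqr_enorm.
have u0 : dot (u - v) (u - v) != 0 by rewrite gt_eqF ?dot_gt0 ?subr_eq0.
have w0 : dot (w - v) (w - v) != 0 by rewrite gt_eqF ?dot_gt0 ?subr_eq0.
have -> : cross (u - v) (w - v) ^+ 2 =
  dot (u - v) (u - v) * dot (w - v) (w - v) - dot (u - v) (w - v) ^+ 2.
  by rewrite -dot_cross_sqr; ring.
by field; rewrite ?u0 ?w0.
Qed.

Lemma cos_angle_unit u v w :
  cos_angle u v w = dot ((enorm (u - v))^-1 *: (u - v)) ((enorm (w - v))^-1 *: (w - v)).
Proof. by rewrite /cos_angle dotZl dotZr invfM; ring. Qed.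

Lemma enorm_unit a : a != 0 -> dot ((enorm a)^-1 *: a) ((enorm a)^-1 *: a) = 1.
Proof.
move=> a0; rewrite dotZl dotZr -sqr_enorm expr2 mulKf ?mulVf // gt_eqF ?enorm_gt0 //.
Qed.

End Faces.

(** * Diameter, inscribed discs and inner normals *)

Section Metric.
Variable R : realType.
Implicit Types (u v w x y a b c d e m n p : 'rV[R]_2) (K S f g : set 'rV[R]_2).
Implicit Types (s : seq 'rV[R]_2).

Lemma convex_polygonP K : convex_polygon K ->
  exists s, affine_hull [set` s] = setT /\ K = convex_hull [set` s].
Proof. by move=> [S [/finite_seqP[s ->] full ->]]; exists s. Qed.

Lemma convex_hull_bounded s : exists B : R, forall x, convex_hull [set` s] x -> enorm x <= B.
Proof.
have [B sB] : exists B : R, forall p, p \in s -> dot p p <= B.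
  have [->|/(argmax_seq (fun p => dot p p)) [p _ pmax]] := eqVneq s [::].
    by exists 0.
  by exists (dot p p).
exists (Num.sqrt B) => x Kx; rewrite ler_wsqrtr //.
(* The functional [x] itself is bounded on the generators, since 2 x.p <= |x|^2 + |p|^2. *)
have : dot x x <= (dot x x + B) / 2.
  apply: (convex_hull_le _ Kx) => p /sB pB.
  have := dot_ge0 (x - p); rewrite dotBl !dotBr (dotC p x); lra.
lra.
Qed.

Lemma diameter_ge s x y : convex_hull [set` s] x -> convex_hull [set` s] y ->
  enorm (x - y) <= diameter (convex_hull [set` s]).
Proof.
move=> Kx Ky; apply: ub_le_sup; last by exists x, y.
have [B KB] := convex_hull_bounded s.
exists (B + B) => _ [x' [y' [Kx' Ky' ->]]].
by apply: (le_trans (ler_enormD _ _)); rewrite enormN lerD ?KB.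
Qed.

Lemma convex_hull3 S u v w (k l : R) : S u -> S v -> S w ->
  0 <= k -> 0 <= l -> k + l <= 1 -> convex_hull S (v + k *: (u - v) + l *: (w - v)).
Proof.
move=> Su Sv Sw k0 l0 kl.
exists 3%N, (fun i : 'I_3 => nth v [:: v; u; w] i),
  (fun i : 'I_3 => nth 0 [:: 1 - k - l; k; l] i); split.
- by move=> [[|[|[|//]]]].
- by move=> [[|[|[|//]]]] //= _; lra.
- by rewrite !big_ord_recl big_ord0 /=; ring.
- by rewrite !big_ord_recl big_ord0 /=; apply: row2P; rewrite !mxE; ring.
Qed.

Lemma cross_le a b : `|cross a b| <= enorm a * enorm b.
Proof.
rewrite -(@ler_pXn2r _ 2) ?nnegrE ?mulr_ge0 ?enorm_ge0 //.
by rewrite real_normK ?num_real // exprMn !sqr_enorm -dot_cross_sqr lerDr sqr_ge0.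
Qed.

(** The disc is centred at the centroid of the triangle, whose barycentric coordinates 1/3 leave
    room for small displacements. *)
Lemma disc_in_hull S u v w : S u -> S v -> S w -> cross (u - v) (w - v) != 0 ->
  exists c (r : R), 0 < r /\ disc c r `<=` convex_hull S.
Proof.
move=> Su Sv Sw; set a := u - v; set b := w - v => D0.
have a0 : 0 < enorm a.
  by apply: enorm_gt0; apply: contraNneq D0 => ->; rewrite /cross !mxE !mul0r subrr.
have b0 : 0 <= enorm b := enorm_ge0 b.
have D1 : 0 < `|cross a b| by rewrite normr_gt0.
set r := `|cross a b| / (6 * (enorm a + enorm b)).
have r0 : 0 < r by rewrite divr_gt0 // mulr_gt0 // ltr_pwDl.
exists (v + 3^-1 *: a + 3^-1 *: b), r; split => // x.
rewrite /disc /=; set y := x - _ => yr.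
(* Cramer's rule for [y] in the basis [a], [b]. The radius gives |k| + |l| <= 1/6, which keeps all
   three barycentric coordinates positive. *)
pose k := cross y b / cross a b; pose l := cross a y / cross a b.
have -> : x = v + (3^-1 + k) *: a + (3^-1 + l) *: b.
  have -> : x = (v + 3^-1 *: a + 3^-1 *: b) + y by rewrite /y addrC subrK.
  suff -> : y = k *: a + l *: b by apply: row2P; rewrite !mxE; ring.
  move: D0; rewrite /k /l /cross; clearbody y a b => D0.
  by apply: row2P; rewrite !mxE; field.
have kl : `|k| + `|l| <= 6^-1.
  rewrite !normrM !normfV -mulrDl ler_pdivrMr //.
  apply: (le_trans (lerD (cross_le y b) (cross_le a y))).
  rewrite (mulrC (enorm a)) -mulrDr (addrC (enorm b)).
  apply: (le_trans (ler_wpM2r _ yr)); first by rewrite addr_ge0 ?enorm_ge0.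
  suff -> : r * (enorm a + enorm b) = 6^-1 * `|cross a b| by [].
  have : enorm a + enorm b != 0 by rewrite gt_eqF // ltr_pwDl.
  by rewrite /r; move: (_ + _) => q q0; field.
have [k1 k2] : - `|k| <= k /\ k <= `|k| by apply/andP; rewrite -ler_norml.
have [l1 l2] : - `|l| <= l /\ l <= `|l| by apply/andP; rewrite -ler_norml.
have [k3 l3] := (normr_ge0 k, normr_ge0 l).
by apply: convex_hull3 => //; lra.
Qed.

Lemma crossDl a b c : cross (a + b) c = cross a c + cross b c.
Proof. by rewrite /cross !mxE; ring. Qed.

Lemma crossBr a b c : cross a (b - c) = cross a b - cross a c.
Proof. by rewrite /cross !mxE; ring. Qed.

Lemma crossZl (k : R) a b : cross (k *: a) b = k * cross a b.
Proof. by rewrite /cross !mxE; ring. Qed.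

Lemma crossZr (k : R) a b : cross a (k *: b) = k * cross a b.
Proof. by rewrite /cross !mxE; ring. Qed.

Lemma cross_rot90 b : cross (rot90 b) b = - dot b b.
Proof. by rewrite /cross dotE !mxE /=; ring. Qed.

Lemma enorm_rot90 b : enorm (rot90 b) = enorm b.
Proof. by rewrite /enorm !dotE !mxE /=; congr Num.sqrt; ring. Qed.

(* Both edge lines at v are at distance at least r from c, whereas these distances
   add up to at most |c - v| times the distance between the unit edge directions. *)
Lemma disc_angle_le K f g u v w c (r h : R) : edges K f -> edges K g -> f <> g ->
  f v -> g v -> f u -> g w -> u != v -> w != v ->
  (forall x, K x -> enorm (x - v) <= h) -> 0 < r -> disc c r `<=` K ->
  2 * r ^+ 2 <= (1 - cos_angle u v w) * h ^+ 2.
Proof.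
move=> Ef Eg fg fv gv fu gw uv wv Kh r0 cK.
have [t [t2 _ cone]] := edges_cone Ef Eg fg fv gv fu gw uv wv.
have ua : u - v != 0 by rewrite subr_eq0.
have wb : w - v != 0 by rewrite subr_eq0.
rewrite cos_angle_unit; set a := _ *: (u - v); set b := _ *: (w - v).
have aa : dot a a = 1 by exact: enorm_unit.
have bb : dot b b = 1 by exact: enorm_unit.
have inv0 e : 0 <= (enorm e)^-1 by rewrite invr_ge0 enorm_ge0.
have cone_a x : K x -> 0 <= t * cross a (x - v).
  by move=> /cone [_]; rewrite /a crossZl mulrCA; apply: mulr_ge0; exact: inv0.
have cone_b x : K x -> 0 <= t * cross (x - v) b.
  by move=> /cone [+ _]; rewrite /b crossZr mulrCA; apply: mulr_ge0; exact: inv0.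
(* For a suitable sign of [k] this is the point of the disc nearest to the edge line of direction
   [e]. *)
have n1 (k : R) e : dot e e = 1 -> k ^+ 2 = r ^+ 2 -> K (c + k *: rot90 e).
  move=> ee k2; apply: cK; rewrite /disc /= addrAC subrr add0r.
  rewrite -(@ler_pXn2r _ 2) ?nnegrE ?enorm_ge0 ?(ltW r0) //.
  by rewrite sqr_enorm dotZl dotZr -sqr_enorm enorm_rot90 sqr_enorm ee mulr1 -expr2 k2.
have hb : r <= t * cross (c - v) b.
  have := cone_b _ (n1 (t * r) b bb _); rewrite exprMn t2 mul1r => /(_ erefl).
  rewrite addrAC (crossDl (c - v)) crossZl cross_rot90 bb mulrDr mulrN1 mulrN mulrA -expr2 t2 mul1r.
  lra.
have ha : r <= t * cross a (c - v).
  have := cone_a _ (n1 (- (t * r)) a aa _); rewrite sqrrN exprMn t2 mul1r => /(_ erefl).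
  rewrite addrAC (crossC a (c - v + _)) (crossDl (c - v)) crossZl cross_rot90 aa (crossC (c - v)).
  rewrite opprD opprK mulrDr mulrN1 opprK mulrN mulrA -expr2 t2 mul1r.
  lra.
have hba : 2 * r <= t * cross (c - v) (b - a).
  by rewrite crossBr (crossC (c - v) a); lra.
have : (2 * r) ^+ 2 <= h ^+ 2 * (2 - 2 * dot a b).
  apply: (@le_trans _ _ ((t * cross (c - v) (b - a)) ^+ 2)).
    by rewrite ler_pXn2r ?nnegrE //; lra.
  rewrite exprMn t2 mul1r.
  have -> : 2 - 2 * dot a b = dot (b - a) (b - a).
    by rewrite dotBl !dotBr aa bb (dotC b); ring.
  apply: (@le_trans _ _ (dot (c - v) (c - v) * dot (b - a) (b - a))).
    by rewrite -dot_cross_sqr lerDr sqr_ge0.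
  rewrite ler_wpM2r ?dot_ge0 // -sqr_enorm.
  have ch : enorm (c - v) <= h.
    apply/Kh/cK; rewrite /disc /= subrr.
    by rewrite /enorm dot0l sqrtr0 ltW.
  by rewrite ler_pXn2r ?nnegrE ?enorm_ge0 // (le_trans _ ch) ?enorm_ge0.
lra.
Qed.

(** In the cone, x - v = k a + l b with k, l >= 0, so |x - v| <= k + l. The opposite of the
    normalized bisector takes the value (k + l) |a + b| / 2 at v - x, and |a + b|^2 = 2 + 2 cos
    theta >= 2 + 2 q. *)
Lemma inner_normal K f g u v w (q : R) : edges K f -> edges K g -> f <> g ->
  f v -> g v -> f u -> g w -> u != v -> w != v ->
  -1 < q -> q <= cos_angle u v w ->
  exists m, enorm m <= 1 /\
    forall x, K x -> Num.sqrt ((1 + q) / 2) * enorm (x - v) <= dot m (v - x).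
Proof.
move=> Ef Eg fg fv gv fu gw uv wv q1.
have [t [t2 D0 cone]] := edges_cone Ef Eg fg fv gv fu gw uv wv.
have ua : u - v != 0 by rewrite subr_eq0.
have wb : w - v != 0 by rewrite subr_eq0.
rewrite cos_angle_unit; set a := _ *: (u - v); set b := _ *: (w - v) => qz.
have aa : dot a a = 1 by exact: enorm_unit.
have bb : dot b b = 1 by exact: enorm_unit.
have inv0 e : e != 0 -> 0 < (enorm e)^-1 by move=> ?; rewrite invr_gt0 enorm_gt0.
have ab : 0 < t * cross a b.
  by rewrite /a /b crossZl crossZr (mulrCA t) (mulrCA t) pmulr_rgt0 ?inv0 // pmulr_rgt0 ?inv0.
have cone_a x : K x -> 0 <= t * cross a (x - v).
  by move=> /cone [_]; rewrite /a crossZl mulrCA; apply: mulr_ge0; rewrite ltW ?inv0.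
have cone_b x : K x -> 0 <= t * cross (x - v) b.
  by move=> /cone [+ _]; rewrite /b crossZr mulrCA; apply: mulr_ge0; rewrite ltW ?inv0.
clearbody a b; set sq := Num.sqrt _.
have sq0 : 0 <= sq := sqrtr_ge0 _.
have nab : enorm (a + b) ^+ 2 = 2 + 2 * dot a b.
  by rewrite sqr_enorm dotDl !dotDr aa bb (dotC b); ring.
have nab_ge : 2 * sq <= enorm (a + b).
  rewrite -(@ler_pXn2r _ 2) ?nnegrE ?enorm_ge0 ?mulr_ge0 // nab exprMn sqr_sqrtr; lra.
have nab0 : 0 < enorm (a + b).
  by apply: lt_le_trans nab_ge; rewrite mulr_gt0 // sqrtr_gt0; lra.
exists (- (enorm (a + b))^-1 *: (a + b)); split.
  by rewrite scaleNr enormN enormZ ?invr_ge0 ?enorm_ge0 // mulVf ?gt_eqF.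
move=> x Kx.
(* [t] cancels in these Cramer quotients but makes both signs visible. *)
pose k := (t * cross (x - v) b) / (t * cross a b).
pose l := (t * cross a (x - v)) / (t * cross a b).
have k0 : 0 <= k by rewrite divr_ge0 ?cone_b // ltW.
have l0 : 0 <= l by rewrite divr_ge0 ?cone_a // ltW.
have xkl : x - v = k *: a + l *: b.
  move: (gt_eqF ab) => /negbT ab0; move: ab0; rewrite /k /l.
  move: (x - v) => y; rewrite mulf_eq0 negb_or => /andP[t0].
  by rewrite /cross => D; apply: row2P; rewrite !mxE; field; rewrite t0 D.
have xn : enorm (x - v) <= k + l.
  rewrite xkl; apply: (le_trans (ler_enormD _ _)).
  by rewrite (enormZ a k0) (enormZ b l0) /enorm aa bb sqrtr1 !mulr1.
have -> : dot (- (enorm (a + b))^-1 *: (a + b)) (v - x) = enorm (a + b) / 2 * (k + l).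
  rewrite -[v - x]opprB -[- (x - v)]scaleN1r dotZl dotZr xkl.
  rewrite dotDr !dotZr !dotDl aa bb (dotC b a).
  have zE : dot a b = enorm (a + b) ^+ 2 / 2 - 1 by rewrite nab; field.
  by rewrite zE; field; rewrite gt_eqF.
apply: (le_trans (ler_wpM2l sq0 xn)); apply: ler_wpM2r; lra.
Qed.

End Metric.

(** Pigeonhole on a grid of mesh 1/k over the square [-1, 1]^2: two points in one cell are closer
    than [e], so numbering the cells is injective on [V]. *)
Lemma separated_card (R : realType) (e : R) : 0 < e ->
  exists N : nat, (0 < N)%N /\ forall (V : set 'rV[R]_2) (m : 'rV[R]_2 -> 'rV[R]_2),
    (forall v, V v -> enorm (m v) <= 1) ->
    (forall v w, V v -> V w -> v != w -> e <= enorm (m v - m w)) ->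
    (V #<= `I_N)%card.
Proof.
move=> e0; pose k := (Num.truncn (2 / e)).+1.
have ke : 2 < k%:R * e by rewrite -ltr_pdivrMr // truncnS_gt.
have k0 : 0 < k%:R :> R by rewrite ltr0n.
(* The value t = 1 falls in cell 2k, so each axis has 2k + 1 cells. *)
clearbody k; pose cell (t : R) := Num.truncn ((t + 1) * k%:R).
have cellP (t : R) : -1 <= t <= 1 ->
    (cell t < k.*2.+1)%N /\ (cell t)%:R <= (t + 1) * k%:R < (cell t).+1%:R.
  move=> /andP[t1 t2].
  have t0 : 0 <= (t + 1) * k%:R by rewrite mulr_ge0 ?(ltW k0) //; lra.
  split; last exact: truncn_itv.
  by rewrite truncn_lt_nat // -addn1 -muln2 natrD natrM; nra.
have sqr_le1 (z : R) : (z ^+ 2 <= 1) = (-1 <= z <= 1).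
  by rewrite -ler_norml -(real_normK (num_real z)) expr_le1.
have coord (x : 'rV[R]_2) : enorm x <= 1 -> -1 <= x 0 0 <= 1 /\ -1 <= x 0 1 <= 1.
  rewrite -(@ler_pXn2r _ 2) ?nnegrE ?enorm_ge0 // sqr_enorm dotE expr1n -!expr2 => x1.
  have := sqr_ge0 (x 0 0); have := sqr_ge0 (x 0 1) => s1 s0.
  by rewrite -!sqr_le1; split; lra.
exists (k.*2.+1 * k.*2.+1)%N; split; first by rewrite muln_gt0.
move=> V m m1 sep.
pose code v := addn (muln (cell (m v 0 0)) k.*2.+1) (cell (m v 0 1)).
have code_lt : code @` V `<=` `I_(k.*2.+1 * k.*2.+1).
  move=> _ [v Vv <-] /=; have [/cellP [c0 _] /cellP [c1 _]] := coord _ (m1 v Vv).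
  rewrite (@leq_trans (muln (cell (m v 0 0)).+1 k.*2.+1)) ?leq_mul2r ?c0 ?orbT //.
  by rewrite /code mulSnr ltn_add2l.
have code_inj : {in V &, injective code}.
  move=> v w; rewrite !inE => Vv Vw; rewrite /code => E.
  have [/cellP [_ v0] /cellP [v1k v1]] := coord _ (m1 v Vv).
  have [/cellP [_ w0] /cellP [w1k w1]] := coord _ (m1 w Vw).
  have E0 : cell (m v 0 0) = cell (m w 0 0).
    by have := congr1 (divn^~ k.*2.+1) E; rewrite /= !divnMDl // !divn_small // !addn0.
  have E1 : cell (m v 0 1) = cell (m w 0 1).
    by move: E; rewrite E0 => /addnI.
  apply/eqP/negPn/negP => /(sep v w Vv Vw).
  apply/negP; rewrite -ltNge -(@ltr_pXn2r _ 2) ?nnegrE ?enorm_ge0 ?(ltW e0) //.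
  rewrite sqr_enorm -(ltr_pM2r (exprn_gt0 2 k0)) dotE !mxE.
  rewrite E0 E1 -!natr1 !mulrDl in v0 v1 w0 w1.
  move: v0 v1 w0 w1 => /andP[v0 v0'] /andP[v1 v1'] /andP[w0 w0'] /andP[w1 w1'].
  set x := m v 0 0 - m w 0 0; set y := m v 0 1 - m w 0 1.
  (* Within a cell both coordinates differ by at most 1/k, and 2 / k^2 < 4 / k^2 < e^2. *)
  have x1 : (x * k%:R) ^+ 2 <= 1.
    by rewrite sqr_le1 /x mulrBl; apply/andP; split; lra.
  have y1 : (y * k%:R) ^+ 2 <= 1.
    by rewrite sqr_le1 /y mulrBl; apply/andP; split; lra.
  have ke2 : 2 ^+ 2 < (k%:R * e) ^+ 2.
    by rewrite ltr_pXn2r ?nnegrE // mulr_ge0 // ltW.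
  rewrite -!expr2 mulrDl -!exprMn (mulrC e); lra.
by rewrite -(card_le_eql (inj_card_eq code_inj)); exact: subset_card_le.
Qed.

(** * Corners: angle conditions as cosine bounds, inradius and heights *)

Section Corners.
Variable R : realType.
Implicit Types (u v w x y a b c d e m n p : 'rV[R]_2) (K S f g : set 'rV[R]_2).
Implicit Types (s : seq 'rV[R]_2) (KK : set (set 'rV[R]_2)).

(** The data behind [interior_angle] with the angle left out, so that its cosine can be used
    directly. *)
Definition corner K f g u v w : Prop :=
  [/\ edges K f /\ edges K g, f <> g,
      edge_vertices K f v /\ edge_vertices K g v,
      edge_vertices K f u /\ edge_vertices K g w & u != v /\ w != v].

Lemma cornerC K f g u v w : corner K f g u v w -> corner K g f w v u.
Proof. by move=> [[? ?] fg [? ?] [? ?] [? ?]]; split => //; exact: nesym. Qed.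

Lemma interior_angleP K v (t : R) : interior_angle K v t <->
  exists f g u w, corner K f g u v w /\ t = acos (cos_angle u v w).
Proof.
split=> [[f [g [u [w [? ? ? ? [? ? ->]]]]]]|[f [g [u [w [[? ? ? ? [? ?]] ->]]]]]];
  by exists f, g, u, w.
Qed.

Lemma corner_notin K f g u v w : corner K f g u v w -> ~ f w.
Proof.
move=> [[[Ff _] [Fg _]] fg [[_ fv] [_ gv]] [_ [_ gw]] [_ wv]] fw.
by apply: fg; exact: (edges_meet Ff Fg fv gv fw gw wv).
Qed.

Lemma vertices_sub K : vertices K `<=` K.
Proof. by move=> v [? [? [_ _ E]]]; have : [set v] v by []; rewrite E => -[]. Qed.

Lemma edge_other_vertex K f v : convex_polygon K -> edges K f ->
  exists2 u, edge_vertices K f u & u != v.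
Proof.
move=> /convex_polygonP[s [full ->]] /(edge_two_vertices full)[x [y [Vx Vy xy]]].
have [xv|xv] := eqVneq x v; last by exists x.
by exists y => //; rewrite -xv eq_sym.
Qed.

(** At least one of the two distinct edges given by [vertex_two_edges] at [v] differs from [f]. *)
Lemma edge_corner K f u v : convex_polygon K -> edges K f ->
  edge_vertices K f v -> edge_vertices K f u -> u != v ->
  exists g w, corner K f g u v w.
Proof.
move=> PK Ef Vfv Vfu uv.
have [g [Eg gv fg]] : exists g, [/\ edges K g, g v & f <> g].
  have [s [full KE]] := convex_polygonP PK.
  have Vv : vertices (convex_hull [set` s]) v by rewrite -KE; case: Vfv.
  have [g [g' [Eg Eg' gv gv' gg]]] := vertex_two_edges full Vv; rewrite -KE in Eg Eg'.
  have [fg|] := pselect (f = g); last by exists g.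
  by exists g'; rewrite fg.
have [w Vgw wv] := edge_other_vertex v PK Eg.
by exists g, w; split => //; split => //; split => //; case: Vfv.
Qed.

Lemma vertex_edge K v : convex_polygon K -> vertices K v -> exists2 f, edges K f & f v.
Proof.
move=> /convex_polygonP[s [full ->]] /(vertex_two_edges full)[f [g [Ef _ fv _ _]]].
by exists f.
Qed.

Lemma vertex_corner K v : convex_polygon K -> vertices K v ->
  exists f g u w, corner K f g u v w.
Proof.
move=> PK Vv; have [f Ef fv] := vertex_edge PK Vv.
have [u Vfu uv] := edge_other_vertex v PK Ef.
have [g [w c]] := edge_corner PK Ef (conj Vv fv) Vfu uv.
by exists f, g, u, w.
Qed.

Lemma polygon_vertex K : convex_polygon K -> exists v, vertices K v.
Proof. by move=> /convex_polygonP[s [full ->]]; exact: vertex_exists. Qed.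

Lemma polygon_diameter_ge K x y : convex_polygon K -> K x -> K y ->
  enorm (x - y) <= diameter K.
Proof. by move=> /convex_polygonP[s [_ ->]]; exact: diameter_ge. Qed.

Lemma diameter_gt0 K : convex_polygon K -> 0 < diameter K.
Proof.
move=> PK; have [v Vv] := polygon_vertex PK.
have [f [g [u [w [_ _ _ [[Vu _] _] [uv _]]]]]] := vertex_corner PK Vv.
apply: lt_le_trans (polygon_diameter_ge PK (vertices_sub Vu) (vertices_sub Vv)).
by rewrite enorm_gt0 ?subr_eq0.
Qed.

(** Cosine is decreasing on [0, pi], so keeping angles away from pi keeps cosines away from -1. As
    [alpha] may be negative and [q] may exceed 1, both are clamped into the range where [cos] and
    [acos] are inverse to each other. *)
Lemma cond_H6P KK : cond_H6 KK <-> exists q : R, -1 < q /\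
  forall K, KK K -> forall f g u v w, corner K f g u v w -> q <= cos_angle u v w.
Proof.
have [pi0 piD] : (0 <= pi :> R) * (0 < pi :> R) by rewrite pi_ge0 pi_gt0.
split=> [[alpha [alpha_pi H]]|[q [q1 H]]].
  pose t := Num.max alpha 0.
  have tI : t \in `[0, pi] by rewrite in_itv /= /t le_max lexx orbT ge_max ltW //= ltW.
  exists (cos t); split.
    by rewrite -cospi ltr_cos // ?in_itv /= ?lexx ?pi0 // gt_max alpha_pi.
  move=> K KKK f g u v w c; have z := cos_angle_itv u v w.
  rewrite -[leRHS]acosK // leNgt ltr_cos // ?in_itv /= ?acos_ge0 ?acos_lepi // -leNgt.
  rewrite le_max (H K KKK v) //; first by case: c => _ _ [[]].
  by apply/interior_angleP; exists f, g, u, w.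
pose q' := Num.min q 0.
have q'1 : -1 < q' <= 1.
  by rewrite /q' lt_min q1 ltrN10 /= ge_min ler01 orbT.
exists (acos q'); split; first exact: acos_ltpi.
move=> K KKK v t _ /interior_angleP[f [g [u [w [c ->]]]]].
have z := cos_angle_itv u v w.
have q'i : -1 <= q' <= 1 by case/andP: q'1 => /ltW -> ->.
rewrite leNgt -ltr_cos ?in_itv /= ?acos_ge0 ?acos_lepi // !acosK // -leNgt.
by rewrite ge_min (H K KKK _ _ _ _ _ c).
Qed.

Lemma cond_H7P KK : cond_H7 KK <-> exists q : R, q < 1 /\
  forall K, KK K -> forall f g u v w, corner K f g u v w -> cos_angle u v w <= q.
Proof.
have [pi0 piD] : (0 <= pi :> R) * (0 < pi :> R) by rewrite pi_ge0 pi_gt0.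
split=> [[alpha [alpha0 H]]|[q [q1 H]]].
  (* Clamped because [alpha] may exceed pi; likewise [q] may lie below -1 in the converse. *)
  pose t := Num.min alpha pi.
  have tI : t \in `[0, pi] by rewrite in_itv /= /t le_min ge_min lexx orbT ltW //= ltW.
  exists (cos t); split.
    by rewrite -cos0 ltr_cos // ?in_itv /= ?lexx ?pi0 // lt_min alpha0.
  move=> K KKK f g u v w c; have z := cos_angle_itv u v w.
  rewrite -[leLHS]acosK // leNgt ltr_cos // ?in_itv /= ?acos_ge0 ?acos_lepi // -leNgt.
  rewrite ge_min (H K KKK v) //; first by case: c => _ _ [[]].
  by apply/interior_angleP; exists f, g, u, w.
pose q' := Num.max q 0.
have q'1 : -1 <= q' < 1.
  by rewrite /q' le_max gt_max q1 ltr01 lerN10 orbT.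
exists (acos q'); split; first exact: acos_gt0.
move=> K KKK v t _ /interior_angleP[f [g [u [w [c ->]]]]].
have z := cos_angle_itv u v w.
have q'i : -1 <= q' <= 1 by case/andP: q'1 => -> /ltW ->.
rewrite leNgt -ltr_cos ?in_itv /= ?acos_ge0 ?acos_lepi // !acosK // -leNgt.
by rewrite le_max (H K KKK _ _ _ _ _ c).
Qed.

(** The bound on each disc passes to the supremum; a disc in the triangle [u], [v], [w] makes the
    set of radii nonempty. Positivity gives the quotient in (H5') its meaning, as division by zero
    yields 0. *)
Lemma inradius_corner K f g u v w : convex_polygon K -> corner K f g u v w ->
  0 < inradius K /\ 2 * inradius K ^+ 2 <= (1 - cos_angle u v w) * diameter K ^+ 2.
Proof.
move=> PK [[Ef Eg] fg [[Vv fv] [_ gv]] [[Vu fu] [Vw gw]] [uv wv]].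
have h0 := diameter_gt0 PK.
have Kh x : K x -> enorm (x - v) <= diameter K.
  by move=> Kx; apply: polygon_diameter_ge => //; exact: vertices_sub.
have disc_le c r : 0 < r -> disc c r `<=` K ->
    2 * r ^+ 2 <= (1 - cos_angle u v w) * diameter K ^+ 2.
  exact: disc_angle_le Ef Eg fg fv gv fu gw uv wv Kh.
have z1 : 0 <= (1 - cos_angle u v w) / 2.
  by have /andP[_ z] := cos_angle_itv u v w; lra.
(* The diameter times sin(theta/2), by the half-angle formula. *)
set B := Num.sqrt ((1 - cos_angle u v w) / 2) * diameter K.
have B0 : 0 <= B by rewrite mulr_ge0 ?sqrtr_ge0 // ltW.
have B2 : 2 * B ^+ 2 = (1 - cos_angle u v w) * diameter K ^+ 2.
  by rewrite exprMn sqr_sqrtr //; field.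
have ubB : ubound [set r | 0 < r /\ exists c, disc c r `<=` K] B.
  move=> r [r0 [c cK]]; rewrite -(@ler_pXn2r _ 2) ?nnegrE ?(ltW r0) //.
  by have := disc_le c r r0 cK; rewrite -B2; lra.
have [c [r [r0 cK]]] : exists c (r : R), 0 < r /\ disc c r `<=` K.
  have [s [_ KE]] := convex_polygonP PK; rewrite KE in Vu Vv Vw.
  rewrite KE; apply: (disc_in_hull (vertex_generator Vu) (vertex_generator Vv)
    (vertex_generator Vw)).
  have [t [_ D0 _]] := edges_cone Ef Eg fg fv gv fu gw uv wv.
  by apply: contraTneq D0 => ->; rewrite mulr0 ltxx.
have rho0 : 0 < inradius K.
  apply: (lt_le_trans r0); apply: ub_le_sup; first by exists B.
  by split => //; exists c.
split=> //; rewrite -B2 ler_pM2l // ler_pXn2r ?nnegrE ?(ltW rho0) //.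
by apply: ge_sup => //; exists r; split => //; exists c.
Qed.

(** [r - dot c w] is |c| times the distance |w - v| sin theta from [w] to the line through [u] and
    [v]. *)
Lemma corner_height K f g u v w c (r C D : R) : convex_polygon K -> corner K f g u v w ->
  (forall x, K x -> dot c x <= r) -> dot c u = r -> dot c v = r ->
  0 <= C -> 0 <= D -> C ^+ 2 <= 1 - cos_angle u v w ^+ 2 ->
  D * diameter K <= enorm (w - v) -> D * C * diameter K * enorm c <= r - dot c w.
Proof.
move=> PK [_ _ _ [_ [Vw _]] [uv wv]] cK cu cv C0 D0 Cz Dw.
have h0 := ltW (diameter_gt0 PK).
have ec : dot (u - v) c = 0 by rewrite dotC dotBr cu cv subrr.
have e0 : 0 < dot (u - v) (u - v) by rewrite dot_gt0 // subr_eq0.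
have height : (r - dot c w) ^+ 2 =
    (1 - cos_angle u v w ^+ 2) * dot (w - v) (w - v) * dot c c.
  (* Squaring [cross_orthogonal] gives the identity up to the factor |u - v|^4. *)
  apply: (mulfI (lt0r_neq0 (mulr_gt0 e0 e0))).
  have := congr1 (fun t : R => t ^+ 2) (cross_orthogonal (w - v) ec).
  have := dot_cross_sqr (u - v) c; rewrite ec expr0n add0r => Y2.
  rewrite /= exprMn (cross_cos_angle uv wv) Y2 (dotBr c) cv => key.
  transitivity ((dot (u - v) (u - v) * (dot c w - r)) ^+ 2); first by ring.
  by rewrite -key; ring.
have w0 : 0 <= r - dot c w by rewrite subr_ge0 cK //; exact: vertices_sub.
rewrite -(@ler_pXn2r _ 2) ?nnegrE ?mulr_ge0 ?enorm_ge0 // height exprMn sqr_enorm.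
rewrite ler_wpM2r ?dot_ge0 // -sqr_enorm -mulrA mulrCA exprMn.
apply: ler_pM => //; rewrite ?sqr_ge0 //.
by rewrite ler_pXn2r ?nnegrE ?mulr_ge0 ?enorm_ge0.
Qed.

Lemma polygon_min_height_ge K (h : R) : convex_polygon K ->
  (forall f x, edges K f -> vertices K x -> ~ f x -> h <= line_dist f x) ->
  h <= min_height K.
Proof.
move=> PK Kh; apply: lb_le_inf => [|_ [f [x [Ef [Vx fx] ->]]]]; last first.
  by apply: Kh => // ?; apply: fx.
(* A corner supplies a vertex off an edge, so the infimum is over a nonempty set. *)
have [v Vv] := polygon_vertex PK.
have [f [g [u [w c]]]] := vertex_corner PK Vv.
have nfw := corner_notin c; case: c => [[Ef _] _ _ [_ [Vw _]] _].
by exists (line_dist f w), f, w; split => //; split => // -[].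
Qed.

(** [corner_height] bounds the heights of [u'] and [v'], the neighbours of the ends of [f], and
    [adjacent_height] passes the bound on to every vertex off [f]. *)
Lemma polygon_min_height K (C D : R) : convex_polygon K -> 0 <= C -> 0 <= D ->
  (forall u v, vertices K u -> vertices K v -> u != v -> D * diameter K <= enorm (u - v)) ->
  (forall f g u v w, corner K f g u v w -> C ^+ 2 <= 1 - cos_angle u v w ^+ 2) ->
  D * C * diameter K <= min_height K.
Proof.
move=> PK C0 D0 KD KC; apply: polygon_min_height_ge => // f x Ef Vx fx.
have [v0 Vv0] := polygon_vertex PK.
have [u Vfu _] := edge_other_vertex v0 PK Ef.
have [v Vfv vu] := edge_other_vertex u PK Ef.
have uv : u != v by rewrite eq_sym.
have [g [v' cv']] := edge_corner PK Ef Vfv Vfu uv.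
have [g' [u' cu']] := edge_corner PK Ef Vfu Vfv vu.
have [Ff _] := Ef; have [c [r [c0 cK fE]]] := Ff.
have level y : f y -> dot c y = r by rewrite fE => -[].
have below y : vertices K y -> ~ f y -> dot c y < r.
  move=> /vertices_sub Ky fy; rewrite lt_neqAle cK // andbT.
  by apply/eqP => cy; apply: fy; rewrite fE.
have [[_ [Fg _]] _ [_ [_ gv]] [_ [Vv' gv']] [_ v'v]] := cv'.
have [[_ [Fg' _]] _ [_ [_ gu]] [_ [Vu' gu']] [_ u'u]] := cu'.
have [[Vu fu] [Vv fv]] := (Vfu, Vfv).
have ngu : ~ g u by move: (corner_notin (cornerC cv')).
have ngv : ~ g' v by move: (corner_notin (cornerC cu')).
have hv : D * C * diameter K * enorm c <= r - dot c v'.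
  by apply: (corner_height PK cv') => //; [exact: level | exact: level | exact: KC cv' | exact: KD].
have hu : D * C * diameter K * enorm c <= r - dot c u'.
  by apply: (corner_height PK cu') => //; [exact: level | exact: level | exact: KC cu' | exact: KD].
have hx : D * C * diameter K * enorm c <= r - dot c x.
  have := adjacent_height c0 cK (vertices_sub Vu) (vertices_sub Vv) (level u fu) (level v fv) uv
    Fg' gu gu' ngv (below _ Vu' (corner_notin cu')) Fg gv gv' ngu
    (below _ Vv' (corner_notin cv')) Vx (below _ Vx fx).
  by case; lra.
(* For [y] on the line of [f], r - c.x = c.(y - x) <= |c| |y - x|. *)
apply: (line_dist_ge fu) => y fy.
rewrite -(ler_pM2r (enorm_gt0 c0)); apply: (le_trans hx).
rewrite -(affine_hull_level level fy) -dotBr enormC mulrC; exact: cauchy_schwarz.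
Qed.

End Corners.

(** * The implications between the conditions *)

Section Implications.
Variables (R : realType) (KK : set (set 'rV[R]_2)).
Variable KK_polygon : forall K, KK K -> convex_polygon K.

Lemma cond_H6_H3 : cond_H6 KK -> cond_H3 KK.
Proof.
move=> /cond_H6P[q [q1 H]].
have s0 : 0 < Num.sqrt ((1 + q) / 2) by rewrite sqrtr_gt0; lra.
have [N [N0 card]] := separated_card (mulr_gt0 (ltr0n R 2) s0).
exists N; split => // K KKK; have PK := KK_polygon KKK.
(* [choice] asks for a value at every point; 0 is a dummy off the vertices. *)
have normal v : exists m, vertices K v -> enorm m <= 1 /\
    forall x, K x -> Num.sqrt ((1 + q) / 2) * enorm (x - v) <= dot m (v - x).
  have [Vv|] := pselect (vertices K v); last by exists 0.
  have [f [g [u [w c]]]] := vertex_corner PK Vv.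
  have [[Ef Eg] fg [[_ fv] [_ gv]] [[_ fu] [_ gw]] [uv wv]] := c.
  have [m mP] := inner_normal Ef Eg fg fv gv fu gw uv wv q1 (H K KKK _ _ _ _ _ c).
  by exists m.
have [m mP] := choice normal.
apply: (card _ m) => [v Vv|v w Vv Vw vw]; first by case: (mP v Vv).
have vw0 : 0 < enorm (v - w) by rewrite enorm_gt0 ?subr_eq0.
(* After multiplication by |v - w|, Cauchy-Schwarz reduces the claim to the sum of the inequalities
   at [v] and at [w]. *)
rewrite -(ler_pM2r vw0); apply: le_trans (cauchy_schwarz _ _).
have := (mP v Vv).2 w (vertices_sub Vw); have := (mP w Vw).2 v (vertices_sub Vv).
have -> : dot (m w) (w - v) = - dot (m w) (v - w).
  by rewrite -(opprB v w) dotC dotNl dotC.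
by rewrite dotBl (enormC w v); lra.
Qed.

Lemma cond_H5'_H7 : cond_H5' KK -> cond_H7 KK.
Proof.
(* From 2 rho^2 <= (1 - cos theta) h^2 and h <= gamma rho follows 2 / gamma^2 <= 1 - cos theta. *)
move=> [gamma [g0 H]]; apply/cond_H7P; exists (1 - 2 / gamma ^+ 2).
have g2 : 0 < gamma ^+ 2 by rewrite exprn_gt0.
split; first by rewrite ltrBlDr ltrDl divr_gt0.
move=> K KKK f g u v w c; have PK := KK_polygon KKK.
have [rho0 rho_le] := inradius_corner PK c.
have h0 := diameter_gt0 PK; have := H K KKK; rewrite ler_pdivrMr // => hg.
have {}hg : diameter K ^+ 2 <= gamma ^+ 2 * inradius K ^+ 2.
  by rewrite -exprMn ler_pXn2r ?nnegrE ?mulr_ge0 // ltW.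
rewrite lerBrDr -lerBrDl ler_pdivrMr // -(ler_pM2r (exprn_gt0 2 h0)) mulrAC.
have := ler_wpM2l (ltW g2) rho_le; lra.
Qed.

(** Of two edges at [u] at most one contains [v]; the line of the other passes through [u], so [v]
    is within |u - v| of it. *)
Lemma cond_H1_H2 : cond_H1 KK -> cond_H2 KK.
Proof.
move=> [C [C0 H]]; exists C; split => // K KKK u v Vu Vv uv.
have PK := KK_polygon KKK.
have [f [g [x [y c]]]] := vertex_corner PK Vu.
have [[Ef Eg] fg [[_ fu] [_ gu]] _ _] := c.
apply: (le_trans (H K KKK)).
have dist_le h : edges K h -> h u -> ~ h v -> min_height K <= enorm (u - v).
  move=> Eh hu hv; apply: (le_trans (min_height_le Eh Vv hv)).
  rewrite enormC; apply: line_dist_le.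
  by have := affine_hull_line 0 hu hu; rewrite scale0r addr0.
have [fv|fv] := pselect (f v); last exact: dist_le Ef fu fv.
apply: (dist_le g Eg gu) => gv; apply: fg.
by apply: (edges_meet Ef.1 Eg.1 fu gu fv gv); rewrite eq_sym.
Qed.

(** The distance |w - v| sin theta from [w] to the line of [f] is at least C h >= C |w - v|, so sin
    theta >= C. This excludes flat and sharp angles at once. *)
Lemma cond_H1_cos_angle : cond_H1 KK -> exists C : R, 0 < C /\
  forall K, KK K -> forall f g u v w, corner K f g u v w -> C <= 1 - cos_angle u v w ^+ 2.
Proof.
move=> [C [C0 H]]; exists (C ^+ 2); split; first exact: exprn_gt0.
move=> K KKK f g u v w c; have PK := KK_polygon KKK.
have fw := corner_notin c.
have [[Ef _] _ [[Vv fv] _] [[_ fu] [Vw _]] [uv wv]] := c.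
have e0 : 0 < dot (u - v) (u - v) by rewrite dot_gt0 // subr_eq0.
have b0 : 0 < dot (w - v) (w - v) by rewrite dot_gt0 // subr_eq0.
have h0 := diameter_gt0 PK.
have Ch := le_trans (H K KKK) (min_height_le Ef Vw fw).
have := line_dist_cross w fu fv uv.
rewrite (cross_cos_angle uv wv) [leRHS]mulrAC (ler_pM2r e0) // => dist.
have bh := polygon_diameter_ge PK (vertices_sub Vw) (vertices_sub Vv).
rewrite -(ler_pM2r b0); apply: le_trans dist.
apply: (@le_trans _ _ ((C * diameter K) ^+ 2)).
  rewrite exprMn ler_pM2l ?exprn_gt0 // -sqr_enorm.
  by rewrite ler_pXn2r ?nnegrE ?enorm_ge0 ?(ltW h0).
rewrite ler_pXn2r ?nnegrE // ?(le_trans _ Ch) ?mulr_ge0 ?ltW //.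
Qed.

Lemma cond_H1_H6_H7 : cond_H1 KK -> cond_H6 KK /\ cond_H7 KK.
Proof.
move=> /cond_H1_cos_angle[C [C0 H]]; split.
  (* As the cosine z lies in [-1, 1], C <= (1 - z) (1 + z) gives C <= 2 (1 + z) and, for (H7), C <=
     2 (1 - z). *)
  apply/cond_H6P; exists (-1 + C / 2); split; first by lra.
  move=> K KKK f g u v w c; have := H K KKK _ _ _ _ _ c.
  by have /andP[] := cos_angle_itv u v w; nra.
apply/cond_H7P; exists (1 - C / 2); split; first by lra.
move=> K KKK f g u v w c; have := H K KKK _ _ _ _ _ c.
by have /andP[] := cos_angle_itv u v w; nra.
Qed.

Lemma cond_H2_H6_H7_H1 : cond_H2 KK -> cond_H6 KK -> cond_H7 KK -> cond_H1 KK.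
Proof.
move=> [D [D0 HD]] /cond_H6P[q [q1 H6]] /cond_H7P[p [p1 H7]].
have s0 : 0 < (1 + q) * (1 - p) by rewrite mulr_gt0 //; lra.
have C0 : 0 < Num.sqrt ((1 + q) * (1 - p)) by rewrite sqrtr_gt0.
(* With z the cosine, sin^2 theta = (1 + z) (1 - z) >= (1 + q) (1 - p). *)
exists (D * Num.sqrt ((1 + q) * (1 - p))); split; first exact: mulr_gt0.
move=> K KKK; apply: (polygon_min_height (KK_polygon KKK) (ltW C0) (ltW D0)) => [u v|f g u v w c].
  exact: HD.
rewrite sqr_sqrtr ?(ltW s0) //.
have := H6 K KKK _ _ _ _ _ c; have := H7 K KKK _ _ _ _ _ c => zp qz.
have -> : 1 - cos_angle u v w ^+ 2 = (1 + cos_angle u v w) * (1 - cos_angle u v w) by ring.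
by apply: ler_pM; lra.
Qed.

End Implications.

Theorem lemma4p3 (R : realType) (KK : set (set 'rV[R]_2))
    (KK_polygon : forall K, KK K -> convex_polygon K /\ nondegenerate_polygon K) :
  [/\ cond_H6 KK -> cond_H3 KK,
      cond_H5' KK -> cond_H7 KK
    & cond_H1 KK <-> [/\ cond_H2 KK, cond_H6 KK & cond_H7 KK]].
Proof.
have polygon K : KK K -> convex_polygon K by move=> /KK_polygon[].
split; [exact: cond_H6_H3 | exact: cond_H5'_H7 | split].
  by move=> H1; have [H6 H7] := cond_H1_H6_H7 polygon H1; split => //; exact: cond_H1_H2.
by case; exact: cond_H2_H6_H7_H1.
Qed.
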